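(* Let $R$ be a commutative semiring, $v:R\to M$ an m-valuation, and $\varphi:R\to U$ a tangibly surjective m-supervaluation covering $v$ (so $\mathcal T(U)\subset\varphi(R)$), with tangible lift $\tilde\varphi:R\to\widetilde U$. Let $\psi_1,\psi_2$ be m-supervaluations covering $v$ with $$\varphi\le\psi_1\le\tilde\varphi,\qquad \varphi\le\psi_2\le\tilde\varphi .$$ Then (i) $\psi_1\ge\psi_2$ if and only if $G(\psi_1)\subset G(\psi_2)$; (ii) $\psi_1\sim\psi_2$ if and only if $G(\psi_1)=G(\psi_2)$.
   Context: A supertropical monoid is a commutative monoid $(U,\cdot)$ with absorbing element $0$ and a distinguished idempotent $e=e_U$ such that $ex=0$ implies $x=0$, together with a total ordering on $eU$ compatible with multiplication and with $0\le a$ for all $a\in eU$. Then $eU$ is a bipotent semiring with unit $e$ and addition $a+b=\max(a,b)$. $\mathcal T(U):=U\setminus eU$, $\mathcal T(U)_0:=\mathcal T(U)\cup\{0\}$. An m-valuation on $R$ is a map $v:R\to M$ to a bipotent semiring $M$ with $v(0)=0$, $v(1)=1$, $v(ab)=v(a)v(b)$, $v(a+b)\le v(a)+v(b)$. An m-supervaluation is a map $\varphi:R\to U$ to a supertropical monoid with $\varphi(0)=0$, $\varphi(1)=1$, $\varphi(ab)=\varphi(a)\varphi(b)$ such that $e\varphi:R\to eU$ is an m-valuation. It covers $v:R\to M$ if $eU=M$ and $e\varphi=v$. For m-supervaluations $\varphi:R\to U$, $\psi:R\to V$: $\varphi\ge\psi$ ($\varphi$ dominates $\psi$) if for all $a,b\in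 R$: $\varphi(a)=\varphi(b)\Rightarrow\psi(a)=\psi(b)$; $e\varphi(a)\le e\varphi(b)\Rightarrow e\psi(a)\le e\psi(b)$; $\varphi(a)\in eU\Rightarrow\psi(a)\in eV$. $\varphi\sim\psi$ means $\varphi\ge\psi$ and $\psi\ge\varphi$. Ghost value set: for an m-supervaluation $\psi:R\to V$ covering $v:R\to M$, $G(\psi):=\psi(R)\cap M=\{\psi(a)\mid a\in R,\ \psi(a)=v(a)\}$. Tangible lift of $\varphi$: let $N:=\varphi(R)$, a submonoid of $U$ containing $\mathcal T(U)_0$, and $x\mapsto\tilde x$ a monoid isomorphism from $N$ onto a copy $\widetilde N$. Let $\widetilde U=\widetilde N\cup M$ be the disjoint union of $\widetilde N$ and $M=eU$ with the zeros identified ($\widetilde N\cap M=\{0\}$), with the given products within $\widetilde N$ and within $M$, and $\tilde x\cdot y=(ex)y$ for $x\in N$, $y\in M$; unit $\tilde 1$, distinguished idempotent $e\in M$, given ordering on $M=e\widetilde U$. This is a supertropical monoid with $\mathcal T(\widetilde U)_0=\widetilde N$, and $\tilde\varphi:R\to\widetilde U$, $\tilde\varphi(a):=\widetilde{\varphi(a)}$, is an m-supervaluation covering $v$. *)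

(* Defs.v *)
From HB Require Import structures.
From mathcomp Require Import all_boot all_algebra.
From mathcomp Require Import boolp classical_sets.

Set Implicit Arguments.
Unset Strict Implicit.
Unset Printing Implicit Defensive.

Import GRing.Theory.
Local Open Scope ring_scope.

(** * Bipotent semirings and m-valuations *)

HB.mixin Record ComPzSemiRing_isBipotent M of GRing.ComPzSemiRing M := {
  addr_bipotent : forall x y : M, x + y = x \/ x + y = y
}.

#[short(type="bipotentSemiRingType")]
HB.structure Definition BipotentSemiRing :=
  {M of GRing.ComPzSemiRing M & ComPzSemiRing_isBipotent M}.

(* The total order of a bipotent semiring, determined by its addition. *)
Definition ble (M : bipotentSemiRingType) (x y : M) : bool := x + y == y.

Definition is_mvaluation (R : comPzSemiRingType) (M : bipotentSemiRingType)
    (v : R -> M) : Prop :=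
  [/\ v 0 = 0, v 1 = 1, {morph v : a b / a * b} &
      forall a b, ble (v (a + b)) (v a + v b)].

Record mvaluation (R : comPzSemiRingType) (M : bipotentSemiRingType) :=
  MValuation { mval_fun :> R -> M; mvalP : is_mvaluation mval_fun }.

(** * Supertropical monoids *)

(* The ghost ideal eU is written as {x | e * x = x}, which is the image of
   x |-> e * x because e is idempotent. The values of [st_le] outside eU are
   irrelevant. *)
HB.mixin Record Monoid_isSupertropical U of Monoid U := {
  st_zero : U;
  st_e : U;
  st_le : rel U;
  st_mulC : commutative (@monoid.mul U);
  st_mul0 : left_zero st_zero (@monoid.mul U);
  st_ee : (st_e * st_e)%g = st_e;
  st_e_eq0 : forall x : U, (st_e * x)%g = st_zero -> x = st_zero;
  st_le_refl : {in [pred x | (st_e * x)%g == x], reflexive st_le};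
  st_le_anti : {in [pred x | (st_e * x)%g == x] &, antisymmetric st_le};
  st_le_trans : {in [pred x | (st_e * x)%g == x] & &, transitive st_le};
  st_le_total : {in [pred x | (st_e * x)%g == x] &, total st_le};
  st_le_mul : {in [pred x | (st_e * x)%g == x] & &, forall c a b,
    st_le a b -> st_le (c * a)%g (c * b)%g};
  st_le0 : {in [pred x | (st_e * x)%g == x], forall a, st_le st_zero a}
}.

#[short(type="supertropicalMonoidType")]
HB.structure Definition SupertropicalMonoid :=
  {U of Monoid U & Monoid_isSupertropical U}.

Arguments st_zero {_}.
Arguments st_e {_}.
Arguments st_le {_}.

Definition is_ghost (U : supertropicalMonoidType) : pred U :=
  [pred x | (st_e * x)%g == x].
Arguments is_ghost {U}.

(** ** The ghost semiring eU *)

Record ghost (U : supertropicalMonoidType) :=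
  Ghost { ghost_val : U; _ : is_ghost ghost_val }.

HB.instance Definition _ (U : supertropicalMonoidType) :=
  [isSub for @ghost_val U].
HB.instance Definition _ (U : supertropicalMonoidType) :=
  [Choice of ghost U by <:].

Section GhostSemiRing.
Variable U : supertropicalMonoidType.
Implicit Types (x y z : U) (a b c : ghost U).

Lemma is_ghost_e x : is_ghost (st_e * x)%g.
Proof. by rewrite /is_ghost /= mulgA st_ee. Qed.

Lemma is_ghost0 : is_ghost (st_zero : U).
Proof. by rewrite /is_ghost /= st_mulC st_mul0. Qed.

Lemma is_ghost1 : is_ghost (st_e : U).
Proof. by rewrite /is_ghost /= st_ee. Qed.

Lemma is_ghostM x y : is_ghost x -> is_ghost (x * y)%g.
Proof. by rewrite /is_ghost /= mulgA => /eqP->. Qed.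

Lemma ghostP a : is_ghost (val a).
Proof. exact: (valP a). Qed.

Definition to_ghost x : ghost U := Ghost (is_ghost_e x).

Definition ghost_zero : ghost U := Ghost is_ghost0.
Definition ghost_one : ghost U := Ghost is_ghost1.
Definition ghost_mul a b : ghost U := Ghost (is_ghostM (val b) (ghostP a)).
Definition ghost_add a b : ghost U := if st_le (val a) (val b) then b else a.

Local Notation le a b := (st_le (val a) (val b)).

Lemma gle_refl a : le a a. Proof. exact: st_le_refl (ghostP a). Qed.

Lemma gle_anti a b : le a b -> le b a -> a = b.
Proof.
by move=> ab ba; apply: val_inj; apply: st_le_anti (ghostP a) (ghostP b) _; rewrite ab.
Qed.

Lemma gle_trans b a c : le a b -> le b c -> le a c.
Proof. exact: st_le_trans (ghostP b) (ghostP a) (ghostP c). Qed.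

Lemma gle_total a b : le a b || le b a.
Proof. exact: st_le_total (ghostP a) (ghostP b). Qed.

Lemma ghost_addC : commutative ghost_add.
Proof.
move=> a b; rewrite /ghost_add.
case: ifP => ab; case: ifP => ba //; first exact: gle_anti.
by have := gle_total a b; rewrite ab ba.
Qed.

Lemma ghost_addA : associative ghost_add.
Proof.
move=> a b c; rewrite /ghost_add.
case bc: (le b c); case ab: (le a b); rewrite ?bc //.
- by rewrite (gle_trans ab bc).
- case ac: (le a c) => //.
  have cb : le c b by have := gle_total b c; rewrite bc.
  have ba : le b a by have := gle_total a b; rewrite ab.
  by have := gle_trans cb ba; move: bc; rewrite (gle_trans ba ac).
Qed.

Lemma ghost_add0 : left_id ghost_zero ghost_add.
Proof. by move=> a; rewrite /ghost_add (st_le0 _ (ghostP a)). Qed.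

Lemma ghost_mulA : associative ghost_mul.
Proof. by move=> a b c; apply: val_inj; rewrite /= mulgA. Qed.

Lemma ghost_mulC : commutative ghost_mul.
Proof. by move=> a b; apply: val_inj; rewrite /= st_mulC. Qed.

Lemma ghost_mul1 : left_id ghost_one ghost_mul.
Proof. by move=> a; apply: val_inj; exact/eqP/ghostP. Qed.

Lemma ghost_mul0 : left_zero ghost_zero ghost_mul.
Proof. by move=> a; apply: val_inj; rewrite /= st_mul0. Qed.

Lemma ghost_mulD : left_distributive ghost_mul ghost_add.
Proof.
suff H a b c : le a b -> ghost_mul (ghost_add a b) c =
    ghost_add (ghost_mul a c) (ghost_mul b c).
  move=> a b c; have /orP[|ba] := gle_total a b; first exact: H.
  by rewrite ghost_addC H // ghost_addC.
move=> ab; rewrite /ghost_add ab (ghost_mulC a) (ghost_mulC b) /=.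
by rewrite (st_le_mul _ _ _ (ghostP c) (ghostP a) (ghostP b) ab).
Qed.

HB.instance Definition _ :=
  GRing.isNmodule.Build (ghost U) ghost_addA ghost_addC ghost_add0.
HB.instance Definition _ := GRing.Nmodule_isComPzSemiRing.Build (ghost U)
  ghost_mulA ghost_mulC ghost_mul1 ghost_mulD ghost_mul0.

Lemma ghost_bipotent a b : a + b = a \/ a + b = b.
Proof. by rewrite /GRing.add /= /ghost_add; case: ifP; [right|left]. Qed.

HB.instance Definition _ :=
  ComPzSemiRing_isBipotent.Build (ghost U) ghost_bipotent.

Lemma ghost_bleE a b : ble a b = st_le (val a) (val b).
Proof.
rewrite /ble /GRing.add /= /ghost_add; case: ifP; rewrite ?eqxx //.
by move=> ab; apply/eqP => E; move: ab; rewrite E gle_refl.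
Qed.

Lemma ghost_addE a b : a + b = if ble a b then b else a.
Proof. by rewrite ghost_bleE. Qed.

End GhostSemiRing.

(** * m-supervaluations *)

Record msupervaluation (R : comPzSemiRingType) (U : supertropicalMonoidType) :=
  MSupervaluation {
    msval_fun :> R -> U;
    msval0 : msval_fun 0 = st_zero;
    msval1 : msval_fun 1 = 1%g;
    msvalM : forall a b, msval_fun (a * b) = (msval_fun a * msval_fun b)%g;
    msval_mval : is_mvaluation (fun a => to_ghost (msval_fun a))
  }.

(* The equality eU = M is rendered by an isomorphism of semirings [i] between
   M and eU; it preserves the order, which is determined by the addition. *)
Definition covers (R : comPzSemiRingType) (M : bipotentSemiRingType)
    (U : supertropicalMonoidType) (i : {rmorphism M -> ghost U})
    (phi : msupervaluation R U) (v : mvaluation R M) : Prop :=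
  bijective i /\ forall a, to_ghost (phi a) = i (v a).

Definition tangibly_surjective (R : comPzSemiRingType)
    (U : supertropicalMonoidType) (phi : msupervaluation R U) : Prop :=
  forall x : U, ~~ is_ghost x -> exists a, phi a = x.

Definition dominates (R : comPzSemiRingType) (U V : supertropicalMonoidType)
    (phi : msupervaluation R U) (psi : msupervaluation R V) : Prop :=
  [/\ forall a b, phi a = phi b -> psi a = psi b,
      forall a b, ble (to_ghost (phi a)) (to_ghost (phi b)) ->
                  ble (to_ghost (psi a)) (to_ghost (psi b)) &
      forall a, is_ghost (phi a) -> is_ghost (psi a)].

Definition msv_equiv (R : comPzSemiRingType) (U V : supertropicalMonoidType)
    (phi : msupervaluation R U) (psi : msupervaluation R V) : Prop :=
  dominates phi psi /\ dominates psi phi.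

(* G(psi), as a subset of M, where M is identified with eV along [i]. *)
Definition ghost_value_set (R : comPzSemiRingType) (M : bipotentSemiRingType)
    (V : supertropicalMonoidType) (i : {rmorphism M -> ghost V})
    (psi : msupervaluation R V) : set M :=
  [set m | exists a, psi a = val (i m)].

(** * The tangible lift *)

Section TangibleLift.
Variables (R : comPzSemiRingType) (U : supertropicalMonoidType).
Variable phi : msupervaluation R U.

Definition msv_range : pred U := fun x => `[< exists a, phi a = x >].

(* The disjoint union of a copy of N = phi(R) and eU with the two zeros
   identified: the left summand is N without its zero. *)
Definition tlift : Type :=
  ({x : U | msv_range x && (x != st_zero)} + ghost U)%type.

HB.instance Definition _ := Choice.on tlift.

(* The map x |-> x~ on N; its values outside N are irrelevant. *)
Definition tl_copy (x : U) : tlift :=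
  if insub x is Some y then inl y else inr 0.

Definition tl_ghost (m : ghost U) : tlift := inr m.

Definition tl_mul (u w : tlift) : tlift :=
  match u, w with
  | inl x, inl y => tl_copy (val x * val y)%g
  | inl x, inr m => tl_ghost (to_ghost (val x) * m)
  | inr m, inl y => tl_ghost (to_ghost (val y) * m)
  | inr m, inr n => tl_ghost (m * n)
  end.

Definition tl_one : tlift := tl_copy 1%g.
Definition tl_zero : tlift := tl_ghost 0.
Definition tl_e : tlift := tl_ghost 1.

Definition tl_le (u w : tlift) : bool :=
  match u, w with
  | inr m, inr n => ble m n
  | _, _ => false
  end.

Lemma msv_rangeM x y : msv_range x -> msv_range y -> msv_range (x * y)%g.
Proof.
move=> /asboolP[a <-] /asboolP[b <-]; apply/asboolP.
by exists (a * b); rewrite msvalM.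
Qed.

Lemma msv_range1 : msv_range 1%g.
Proof. by apply/asboolP; exists 1; rewrite msval1. Qed.

Lemma to_ghostM (x y : U) : to_ghost (x * y)%g = to_ghost x * to_ghost y.
Proof.
apply: val_inj => /=.
have xey : (x * (st_e * y) = st_e * (x * y))%g by rewrite mulgA (st_mulC x) mulgA.
by rewrite -mulgA xey [RHS]mulgA st_ee.
Qed.

Lemma to_ghost0 : to_ghost (st_zero : U) = 0.
Proof. by apply: val_inj; rewrite /= st_mulC st_mul0. Qed.

Lemma to_ghost1 : to_ghost (1%g : U) = 1.
Proof. by apply: val_inj; rewrite /= mulg1. Qed.

Lemma tl_copy0 : tl_copy st_zero = tl_zero.
Proof. by rewrite /tl_copy insubF // eqxx andbF. Qed.

Lemma tl_copy_val (x : {x : U | msv_range x && (x != st_zero)}) :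
  tl_copy (val x) = inl x.
Proof. by rewrite /tl_copy valK. Qed.

Lemma tl_copyT (x : U) (Px : msv_range x && (x != st_zero)) :
  tl_copy x = inl (exist _ x Px).
Proof. by rewrite -tl_copy_val. Qed.

Variant tlift_spec : tlift -> Type :=
  | TLCopy x of msv_range x & x != st_zero : tlift_spec (tl_copy x)
  | TLGhost m : tlift_spec (tl_ghost m).

Lemma tliftP u : tlift_spec u.
Proof.
case: u => [x|m]; last exact: TLGhost.
by rewrite -tl_copy_val; have /andP[] := valP x; exact: TLCopy.
Qed.

Lemma tl_mul_copyg x m : msv_range x ->
  tl_mul (tl_copy x) (tl_ghost m) = tl_ghost (to_ghost x * m).
Proof.
move=> Nx; have [->|nz] := eqVneq x st_zero.
  by rewrite tl_copy0 to_ghost0 /= !mul0r.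
have Px : msv_range x && (x != st_zero) by rewrite Nx nz.
by rewrite (tl_copyT Px).
Qed.

Lemma tl_mul_copy x y : msv_range x -> msv_range y ->
  tl_mul (tl_copy x) (tl_copy y) = tl_copy (x * y)%g.
Proof.
move=> Nx Ny; have [->|ynz] := eqVneq y st_zero.
  by rewrite tl_copy0 tl_mul_copyg // mulr0 st_mulC st_mul0 tl_copy0.
have Py : msv_range y && (y != st_zero) by rewrite Ny ynz.
have [->|xnz] := eqVneq x st_zero.
  by rewrite st_mul0 tl_copy0 (tl_copyT Py) /= mulr0.
have Px : msv_range x && (x != st_zero) by rewrite Nx xnz.
by rewrite (tl_copyT Px) (tl_copyT Py).
Qed.

Lemma tl_mulC : commutative tl_mul.
Proof.
by move=> [x|m] [y|n] //=; [rewrite st_mulC | rewrite mulrC].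
Qed.

Lemma tl_mul_gg m n : tl_mul (tl_ghost m) (tl_ghost n) = tl_ghost (m * n).
Proof. by []. Qed.

Lemma tl_mul_gcopy x m : msv_range x ->
  tl_mul (tl_ghost m) (tl_copy x) = tl_ghost (to_ghost x * m).
Proof. by move=> Nx; rewrite tl_mulC tl_mul_copyg. Qed.

Lemma tl_mulA : associative tl_mul.
Proof.
move=> u1 u2 u3.
case: (tliftP u1) => [x Nx _|m]; case: (tliftP u2) => [y Ny _|n];
  case: (tliftP u3) => [z Nz _|p];
  rewrite ?(tl_mul_copy, tl_mul_copyg, tl_mul_gcopy, tl_mul_gg) ?msv_rangeM //.
- by rewrite mulgA.
- by rewrite to_ghostM mulrA.
- by rewrite mulrCA.
- by rewrite mulrA.
- by rewrite to_ghostM mulrA [to_ghost z * _]mulrC.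
- by rewrite mulrCA mulrA.
- by rewrite mulrCA.
- by rewrite mulrA.
Qed.

Lemma tl_mul1 : left_id tl_one tl_mul.
Proof.
move=> u; case: (tliftP u) => [x Nx _|m].
  by rewrite tl_mul_copy ?msv_range1 // mul1g.
by rewrite tl_mul_copyg ?msv_range1 // to_ghost1 mul1r.
Qed.

Lemma tl_mulr1 : right_id tl_one tl_mul.
Proof. by move=> u; rewrite tl_mulC tl_mul1. Qed.

HB.instance Definition _ := isMonoid.Build tlift tl_mulA tl_mul1 tl_mulr1.

Lemma tl_mul0 : left_zero tl_zero tl_mul.
Proof. by case=> [x|m] /=; rewrite ?mulr0 ?mul0r. Qed.

Lemma tl_ee : tl_mul tl_e tl_e = tl_e.
Proof. by rewrite /= mulr1. Qed.

Lemma tl_e_eq0 u : tl_mul tl_e u = tl_zero -> u = tl_zero.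
Proof.
case: (tliftP u) => [x Nx _|m]; last by rewrite /= mul1r.
rewrite tl_mul_gcopy // mulr1 => -[ex0].
by rewrite (st_e_eq0 _ ex0) tl_copy0.
Qed.

Lemma tl_ghostP u : u \in [pred x | tl_mul tl_e x == x] ->
  exists m, u = tl_ghost m.
Proof.
by rewrite inE => /eqP<-; case: u => [x|m] /=; eexists; reflexivity.
Qed.

Lemma tl_le_refl : {in [pred x | tl_mul tl_e x == x], reflexive tl_le}.
Proof. by move=> _ /tl_ghostP[m ->] /=; rewrite ghost_bleE gle_refl. Qed.

Lemma tl_le_anti : {in [pred x | tl_mul tl_e x == x] &, antisymmetric tl_le}.
Proof.
move=> _ _ /tl_ghostP[m ->] /tl_ghostP[n ->] /=.
by rewrite !ghost_bleE => /andP[mn nm]; rewrite (gle_anti mn nm).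
Qed.

Lemma tl_le_trans : {in [pred x | tl_mul tl_e x == x] & &, transitive tl_le}.
Proof.
move=> _ _ _ /tl_ghostP[m ->] /tl_ghostP[n ->] /tl_ghostP[p ->] /=.
rewrite !ghost_bleE; exact: gle_trans.
Qed.

Lemma tl_le_total : {in [pred x | tl_mul tl_e x == x] &, total tl_le}.
Proof.
move=> _ _ /tl_ghostP[m ->] /tl_ghostP[n ->] /=.
by rewrite !ghost_bleE gle_total.
Qed.

Lemma tl_le_mul : {in [pred x | tl_mul tl_e x == x] & &, forall c a b,
  tl_le a b -> tl_le (tl_mul c a) (tl_mul c b)}.
Proof.
move=> _ _ _ /tl_ghostP[m ->] /tl_ghostP[n ->] /tl_ghostP[p ->] /=.
by rewrite /ble -mulrDr => /eqP->.
Qed.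

Lemma tl_le0 : {in [pred x | tl_mul tl_e x == x], forall a, tl_le tl_zero a}.
Proof. by move=> _ /tl_ghostP[m ->]; rewrite /= /ble add0r. Qed.

HB.instance Definition _ := Monoid_isSupertropical.Build tlift
  tl_mulC tl_mul0 tl_ee tl_e_eq0 tl_le_refl tl_le_anti tl_le_trans tl_le_total
  tl_le_mul tl_le0.

(* The isomorphism from M = eU onto eU~ is [gtl] below. *)
Definition tilde_fun (a : R) : tlift := tl_copy (phi a).

Lemma msv_range_val a : msv_range (phi a).
Proof. by apply/asboolP; exists a. Qed.

Lemma is_ghost_tl_ghost m : is_ghost (tl_ghost m).
Proof. by apply/eqP; rewrite [LHS]tl_mul_gg mul1r. Qed.

Definition gtl (m : ghost U) : ghost tlift := Ghost (is_ghost_tl_ghost m).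

Lemma gtl_ble m n : ble (gtl m) (gtl n) = ble m n.
Proof. by rewrite ghost_bleE. Qed.

Lemma gtlD : {morph gtl : m n / m + n}.
Proof. by move=> m n; rewrite !ghost_addE gtl_ble; case: ifP. Qed.

Lemma to_ghost_tilde a : to_ghost (tilde_fun a) = gtl (to_ghost (phi a)).
Proof.
by apply: val_inj; rewrite /= [LHS]tl_mul_gcopy ?msv_range_val // mulr1.
Qed.

Lemma tilde0 : tilde_fun 0 = st_zero.
Proof. by rewrite /tilde_fun msval0 tl_copy0. Qed.

Lemma tilde1 : tilde_fun 1 = 1%g.
Proof. by rewrite /tilde_fun msval1. Qed.

Lemma tildeM a b : tilde_fun (a * b) = (tilde_fun a * tilde_fun b)%g.
Proof.
by rewrite /tilde_fun msvalM; apply/esym/tl_mul_copy; exact: msv_range_val.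
Qed.

Lemma tilde_mval : is_mvaluation (fun a => to_ghost (tilde_fun a)).
Proof.
have [v0 v1 vM vD] := msval_mval phi.
split=> [||a b|a b].
- by apply: val_inj; rewrite to_ghost_tilde v0.
- by apply: val_inj; rewrite to_ghost_tilde v1.
- by rewrite !to_ghost_tilde vM; apply: val_inj.
- by rewrite !to_ghost_tilde -gtlD gtl_ble.
Qed.

Definition tangible_lift : msupervaluation R tlift :=
  MSupervaluation tilde0 tilde1 tildeM tilde_mval.

Lemma tlift_tangible0 (u : tlift) :
  (~~ is_ghost u \/ u = st_zero) <-> exists a, tangible_lift a = u.
Proof.
split=> [|[a <-]].
  case: (tliftP u) => [x /asboolP[a <-] _ _|m]; first by exists a.
  case=> [|->]; first by rewrite is_ghost_tl_ghost.
  by exists 0; exact: msval0.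
have [a0|nz] := eqVneq (phi a) st_zero.
  by right; rewrite /= /tilde_fun a0 tl_copy0.
left; apply/negP => /tl_ghostP[m]; rewrite /= /tilde_fun.
have Pa : msv_range (phi a) && (phi a != st_zero) by rewrite msv_range_val nz.
by rewrite (tl_copyT Pa).
Qed.

End TangibleLift.

(* Main.v *)
Require Import Defs.
From HB Require Import structures.
From mathcomp Require Import all_boot all_algebra.
From mathcomp Require Import boolp classical_sets.
Local Open Scope ring_scope.
Local Open Scope classical_set_scope.

(* A supervaluation psi with phi <= psi <= phi~ has exactly the fibres of phi,
   because phi and phi~ have the same fibres. Hence psi1 and psi2 can only
   differ in which elements they send to ghosts. If psi1 a is a ghost and
   v a = v b with psi2 b a ghost, then phi a and phi b are ghosts of equal
   value, so phi a = phi b, and therefore psi2 a = psi2 b is a ghost. *)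

Lemma is_ghost_val_to_ghost (U : supertropicalMonoidType) (x : U) :
  is_ghost x -> val (to_ghost x) = x.
Proof. by move=> /eqP. Qed.

(** The order is the equation [x + y = y], which an injective morphism preserves and reflects. *)
Lemma ble_rmorph (M N : bipotentSemiRingType) (i : {rmorphism M -> N}) :
  injective i -> forall x y, ble (i x) (i y) = ble x y.
Proof. by move=> inj_i x y; rewrite /ble -GRing.rmorphD (inj_eq inj_i). Qed.

(** A ghost [psi a] is its own image under multiplication by [e], hence equals [val (i (v a))] by
    covering. *)
Lemma ghost_value_setP (R : comPzSemiRingType) (M : bipotentSemiRingType)
    (v : mvaluation R M) (V : supertropicalMonoidType)
    (i : {rmorphism M -> ghost V}) (psi : msupervaluation R V) (m : M) :
  covers i psi v ->
  ghost_value_set i psi m <-> exists2 a, is_ghost (psi a) & v a = m.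
Proof.
move=> [/bij_inj inj_i cov]; split=> [[a psia]|[a ga <-]]; exists a.
- by rewrite psia; exact: ghostP.
- apply: inj_i; rewrite -cov psia; apply: val_inj.
  by apply: is_ghost_val_to_ghost; exact: ghostP.
- by rewrite -cov is_ghost_val_to_ghost.
Qed.

(** The lift is [tl_copy] after [phi], so it identifies whatever [phi] identifies. *)
Lemma dominates_tilde_fibre (R : comPzSemiRingType)
    (U V : supertropicalMonoidType) (phi : msupervaluation R U)
    (psi : msupervaluation R V) :
  dominates (tangible_lift phi) psi ->
  forall a b, phi a = phi b -> psi a = psi b.
Proof. by case=> fib _ _ a b ab; apply: fib; rewrite /= /tilde_fun ab. Qed.

Lemma dominates_iff_ghost_value_set
    (R : comPzSemiRingType) (M : bipotentSemiRingType) (v : mvaluation R M)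
    (U V1 V2 : supertropicalMonoidType) (phi : msupervaluation R U)
    (psi1 : msupervaluation R V1) (psi2 : msupervaluation R V2)
    (iU : {rmorphism M -> ghost U})
    (i1 : {rmorphism M -> ghost V1}) (i2 : {rmorphism M -> ghost V2}) :
  covers iU phi v -> covers i1 psi1 v -> covers i2 psi2 v ->
  dominates psi1 phi -> dominates psi2 phi ->
  dominates (tangible_lift phi) psi2 ->
  dominates psi1 psi2 <->
    ghost_value_set i1 psi1 `<=` ghost_value_set i2 psi2.
Proof.
move=> covU cov1 cov2 [fib1 _ gh1] [_ _ gh2] /dominates_tilde_fibre fib2.
split=> [[_ _ gh12] m|G12].
  move=> /(ghost_value_setP _ _ _ _ _ _ _ cov1)[a ga <-].
  by apply/(ghost_value_setP _ _ _ _ _ _ _ cov2); exists a => //; exact: gh12.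
split=> [a b /fib1/fib2 //|a b|a ga].
  (* Both ghost orders pull back to the order of [v a] and [v b] in [M]. *)
  have [/bij_inj inj1 c1] := cov1; have [/bij_inj inj2 c2] := cov2.
  by rewrite !c1 !c2 !ble_rmorph.
have [|b gb vba] := (ghost_value_setP _ _ _ _ _ _ (v a) cov2).1.
  by apply/G12/(ghost_value_setP _ _ _ _ _ _ _ cov1); exists a.
(* It remains to show [phi a = phi b]: both are ghosts, so they are determined by [v a] and
   [v b]. *)
rewrite (fib2 a b) // -(is_ghost_val_to_ghost _ _ (gh1 _ ga)).
by rewrite -(is_ghost_val_to_ghost _ _ (gh2 _ gb)) !covU.2 vba.
Qed.

Theorem theorem2p4
  (R : comPzSemiRingType) (M : bipotentSemiRingType) (v : mvaluation R M)
  (U : supertropicalMonoidType) (phi : msupervaluation R U)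
  (iU : {rmorphism M -> ghost U})
  (V1 V2 : supertropicalMonoidType)
  (psi1 : msupervaluation R V1) (psi2 : msupervaluation R V2)
  (i1 : {rmorphism M -> ghost V1}) (i2 : {rmorphism M -> ghost V2})
  (phi_covers : covers iU phi v)
  (phi_tsurj : tangibly_surjective phi)
  (psi1_covers : covers i1 psi1 v)
  (psi2_covers : covers i2 psi2 v)
  (phi_le_psi1 : dominates psi1 phi)
  (psi1_le_tilde : dominates (tangible_lift phi) psi1)
  (phi_le_psi2 : dominates psi2 phi)
  (psi2_le_tilde : dominates (tangible_lift phi) psi2) :
  (dominates psi1 psi2 <->
     ghost_value_set i1 psi1 `<=` ghost_value_set i2 psi2) /\
  (msv_equiv psi1 psi2 <->
     ghost_value_set i1 psi1 = ghost_value_set i2 psi2).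
Proof.
have H12 := dominates_iff_ghost_value_set _ _ _ _ _ _ _ _ _ _ _ _ phi_covers
  psi1_covers psi2_covers phi_le_psi1 phi_le_psi2 psi2_le_tilde.
(* Exchanging the roles of [psi1] and [psi2] gives the reverse inclusion needed for (ii). *)
have H21 := dominates_iff_ghost_value_set _ _ _ _ _ _ _ _ _ _ _ _ phi_covers
  psi2_covers psi1_covers phi_le_psi2 phi_le_psi1 psi1_le_tilde.
split=> //; split=> [[/H12 G12 /H21 G21]|G]; first exact/seteqP.
by split; [apply/H12 | apply/H21]; rewrite G.
Qed.
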